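(* Let $\mathcal S$ be the Airy sheet, let $a,b\in\mathbb R$, and let $B,B'$ be two independent rate two Brownian motions on $[a,\infty)$ and $[b,\infty)$ with $B(a)=0$ and $B'(b)=0$ respectively. Then the law of the centred Airy sheet $(x,y)\mapsto\mathcal S(x,y)-\mathcal S(a,b)$ on the space of continuous functions on $[a,\infty)\times[b,\infty)$ vanishing at $(a,b)$ is not absolutely continuous with respect to the law of the additive Brownian motion $(x,y)\mapsto B(x)+B'(y)$ on the same space.
   Context: Rate two means that the quadratic variation on $[s,t]$ is $2(t-s)$. A measure $\mu$ is absolutely continuous with respect to $\nu$ if $\nu(A)=0$ implies $\mu(A)=0$. Last passage values: for a sequence $f=(f_i)$ of continuous functions on $\mathbb R$, $x\le y$ and integers $m\le k$, set $f[(x,k)\to(y,m)]=\sup\sum_{i=m}^{k}\big(f_i(s_{i-1})-f_i(s_i)\big)$, the supremum over $x=s_k\le s_{k-1}\le\dots\le s_m\le s_{m-1}=y$. Airy line ensemble: $\mathcal A=(\mathcal A_1>\mathcal A_2>\cdots)$ is the random sequence of continuous functions on $\mathbb R$ such that $(\mathcal A_i(x)+x^2)_{i\ge1}$ is the stationary Airy line ensemble, i.e. for any finite set of times the point process of its values is determinantal with the extended Airy kernel $K(s,x;t,y)=\int_0^\infty e^{-\lambda(s-t)}\mathrm{Ai}(x+\lambda)\mathrm{Ai}(y+\lambda)\,d\lambda$ for $s\ge t$ and $-\int_{-\infty}^0 e^{-\lambda(s-t)}\mathrm{Ai}(x+\lambda)\mathrm{Ai}(y+\lambda)\,d\lambda$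 for $s<t$. Airy sheet: $\mathcal S:\mathbb R^2\to\mathbb R$ is the (unique in law) random continuous function such that $\mathcal S(\cdot+c,\cdot+c)\overset{d}{=}\mathcal S$ for all $c\in\mathbb R$, and such that $\mathcal S$ can be coupled with $\mathcal A$ so that $\mathcal S(0,\cdot)=\mathcal A_1(\cdot)$ and almost surely for all rationals $x>0$ and $y,z$ there is a random $K$ with $\mathcal S(x,z)-\mathcal S(x,y)=\mathcal A[x_k\to(z,1)]-\mathcal A[x_k\to(y,1)]$ for all $k\ge K$, where $x_k=(-\sqrt{k/(2x)},k)$. *)

(* Defs.v *)
From HB Require Import structures.
From mathcomp Require Import all_boot all_order all_algebra.
From mathcomp Require Import all_classical all_reals all_analysis.

Set Implicit Arguments.
Unset Strict Implicit.
Unset Printing Implicit Defensive.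

Import Order.TTheory GRing.Theory Num.Theory.
Import numFieldNormedType.Exports.

Local Open Scope classical_set_scope.
Local Open Scope ring_scope.

(** Spaces of continuous functions, with the topology of uniform convergence on
    compact sets (which is the compact-open topology, see
    [compact_open_fam_compactP]) and its Borel sigma-algebra. *)

Definition cspace (R : realType) (T : topologicalType) : Type :=
  continuousType T R.

Definition cspace_fun (R : realType) (T : topologicalType) (f : cspace R T) :
  T -> R := Continuous.sort f.

Coercion cspace_fun : cspace >-> Funclass.

Section cspace_structures.
Variables (R : realType) (T : topologicalType).

HB.instance Definition _ := Choice.on (cspace R T).
HB.instance Definition _ :=
  isPointed.Build (cspace R T) (cst 0 : continuousType T R).
HB.instance Definition _ := Topological.copy (cspace R T)
  (initial_topology
    (fun f : cspace R T => cspace_fun f : {compact-open, T -> R})).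
HB.instance Definition _ := Measurable.copy (cspace R T)
  (g_sigma_algebraType (@open (cspace R T))).

End cspace_structures.

(** Continuous functions on [T] vanishing at [p]. *)
Definition cspace0 (R : realType) (T : topologicalType) (p : T) : Type :=
  {f : cspace R T | f p == 0}.

Definition cspace0_fun (R : realType) (T : topologicalType) (p : T)
  (f : cspace0 R p) : T -> R := cspace_fun (sval f).

Coercion cspace0_fun : cspace0 >-> Funclass.

Section cspace0_structures.
Variables (R : realType) (T : topologicalType) (p : T).

HB.instance Definition _ := Choice.on (cspace0 R p).
HB.instance Definition _ := isPointed.Build (cspace0 R p)
  (exist (fun f : cspace R T => f p == 0) point (eqxx 0)).
HB.instance Definition _ := Topological.copy (cspace0 R p)
  (initial_topology
    (fun f : cspace0 R p => cspace0_fun f : {compact-open, T -> R})).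
HB.instance Definition _ := Measurable.copy (cspace0 R p)
  (g_sigma_algebraType (@open (cspace0 R p))).

End cspace0_structures.

Section cspace_constructions.
Variable R : realType.

Definition to_cspace (T : topologicalType) (f : T -> R) (cf : continuous f) :
  cspace R T := (mkcts cf : continuousType T R).

Definition to_cspace0 (T : topologicalType) (p : T) (f : T -> R)
    (cf : continuous f) (f0 : f p = 0) : cspace0 R p :=
  exist (fun g : cspace R T => g p == 0) (to_cspace cf) (introT eqP f0).

Lemma cspace_continuous (T : topologicalType) (f : cspace R T) :
  continuous (f : T -> R).
Proof. exact: (@cts_fun _ _ (f : continuousType T R)). Qed.

Lemma cspace0_continuous (T : topologicalType) (p : T) (f : cspace0 R p) :
  continuous (f : T -> R).
Proof. exact: cspace_continuous. Qed.

Lemma cspace0_base (T : topologicalType) (p : T) (f : cspace0 R p) : f p = 0.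
Proof. exact/eqP/(svalP f). Qed.

Definition halfline (a : R) : topologicalType := set_type [set x : R | a <= x].

Definition halfline_val (a : R) (t : halfline a) : R := set_val t.

Definition halfline_start (a : R) : halfline a :=
  exist (fun x => x \in [set x : R | a <= x]) a (mem_set (lexx a)).

Definition quadrant (a b : R) : topologicalType :=
  (halfline a * halfline b)%type.

Definition corner (a b : R) : quadrant a b :=
  (halfline_start a, halfline_start b).

Lemma halfline_val_continuous (a : R) : continuous (@halfline_val a).
Proof. exact: initial_continuous. Qed.

Lemma comp_fst_continuous (T1 T2 U : topologicalType) (f : T1 -> U) :
  continuous f -> continuous (fun p : T1 * T2 => f p.1).
Proof.
move=> cf p.
exact: (cvg_comp _ _ (@cvg_fst _ _ (nbhs p.1) (nbhs p.2) _) (cf p.1)).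
Qed.

Lemma comp_snd_continuous (T1 T2 U : topologicalType) (f : T2 -> U) :
  continuous f -> continuous (fun p : T1 * T2 => f p.2).
Proof.
move=> cf p.
exact: (cvg_comp _ _ (@cvg_snd _ _ (nbhs p.1) (nbhs p.2) _) (cf p.2)).
Qed.

Lemma pair_map_continuous (T1 T2 U1 U2 : topologicalType) (f : T1 -> U1)
    (g : T2 -> U2) : continuous f -> continuous g ->
  continuous (fun p : T1 * T2 => (f p.1, g p.2)).
Proof.
move=> cf cg p.
apply: (@cvg_pair _ _ _ (nbhs p) (nbhs (f p.1)) (nbhs (g p.2))).
  exact: comp_fst_continuous.
exact: comp_snd_continuous.
Qed.

Lemma diagonal_shift_continuous (c : R) (f : cspace R (R * R)%type) :
  continuous (fun p : R * R => f (p.1 + c, p.2 + c)).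
Proof.
have cc : continuous (fun x : R => x + c).
  by move=> x; apply: cvgD; [exact: cvg_id|exact: cvg_cst].
have cv := pair_map_continuous cc cc.
move=> p; exact: (cvg_comp _ _ (cv p)
  (@cspace_continuous _ f (p.1 + c, p.2 + c))).
Qed.

Definition diagonal_shift (c : R) (f : cspace R (R * R)%type) :
  cspace R (R * R)%type := to_cspace (@diagonal_shift_continuous c f).

Lemma centre_continuous (a b : R) (f : cspace R (R * R)%type) :
  continuous (fun p : quadrant a b => f (halfline_val p.1, halfline_val p.2) - f (a, b)).
Proof.
move=> p; apply: cvgB; last exact: cvg_cst.
have cv := pair_map_continuous (@halfline_val_continuous a)
  (@halfline_val_continuous b).
exact: (cvg_comp _ _ (cv p)
  (@cspace_continuous _ f (halfline_val p.1, halfline_val p.2))).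
Qed.

Lemma centre_corner (a b : R) (f : cspace R (R * R)%type) :
  f (halfline_val (corner a b).1, halfline_val (corner a b).2) - f (a, b) = 0.
Proof. exact: subrr. Qed.

Definition centred_path (a b : R) (f : cspace R (R * R)%type) :
    cspace0 R (corner a b) :=
  to_cspace0 (@centre_continuous a b f) (centre_corner a b f).

Lemma additive_continuous (a b : R) (f : cspace0 R (halfline_start a))
    (g : cspace0 R (halfline_start b)) :
  continuous (fun p : quadrant a b => f p.1 + g p.2).
Proof.
move=> p; apply: cvgD.
  by apply: comp_fst_continuous; exact: cspace0_continuous.
by apply: comp_snd_continuous; exact: cspace0_continuous.
Qed.

Lemma additive_corner (a b : R) (f : cspace0 R (halfline_start a))
    (g : cspace0 R (halfline_start b)) :
  f (corner a b).1 + g (corner a b).2 = 0.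
Proof. by rewrite !cspace0_base addr0. Qed.

Definition additive_path (a b : R) (f : cspace0 R (halfline_start a))
    (g : cspace0 R (halfline_start b)) : cspace0 R (corner a b) :=
  to_cspace0 (@additive_continuous a b f g) (additive_corner f g).

End cspace_constructions.

Section probability_notions.
Variable R : realType.

(** For measures this is [mu `<< nu], see [null_content_dominatesP]; no
    [content] structure on [mu] and [nu] is required here, so that it applies
    to a bare [pushforward]. *)
Definition absolutely_continuous d (E : measurableType d)
    (mu nu : set E -> \bar R) :=
  forall A, measurable A -> nu A = 0%E -> mu A = 0%E.

Definition same_law d1 d2 d (O1 : measurableType d1) (O2 : measurableType d2)
    (E : measurableType d) (P1 : probability O1 R) (P2 : probability O2 R)
    (X1 : O1 -> E) (X2 : O2 -> E) :=
  forall A, measurable A -> pushforward P1 X1 A = pushforward P2 X2 A.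

Definition independent d d1 d2 (O : measurableType d) (E1 : measurableType d1)
    (E2 : measurableType d2) (P : probability O R) (X : O -> E1) (Y : O -> E2) :=
  forall U V, measurable U -> measurable V ->
    P (X @^-1` U `&` Y @^-1` V) = (P (X @^-1` U) * P (Y @^-1` V))%E.

(** [normal_prob m s] has standard deviation [s], so the increment over [s, t]
    has variance [2 * (t - s)]. *)
Definition rate_two_brownian d (O : measurableType d) (P : probability O R)
    (a : R) (B : O -> cspace0 R (halfline_start a)) :=
  [/\ measurable_fun setT B,
   (forall s t : halfline a, halfline_val s < halfline_val t ->
     forall D : set R, measurable D ->
       P [set w | D (B w t - B w s)] =
       normal_prob 0 (Num.sqrt (2 * (halfline_val t - halfline_val s))) D) &
   (forall (n : nat) (t : nat -> halfline a) (D : nat -> set R),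
     (forall i, halfline_val (t i) <= halfline_val (t i.+1)) ->
     (forall i, measurable (D i)) ->
     let incr i w := B w (t i.+1) - B w (t i) in
     P (\bigcap_(i in `I_n) (incr i @^-1` D i)) =
     (\prod_(i < n) P (incr i @^-1` D i))%E)].

(** Iterated integral over the product of the sets [D], all with respect to
    [nu]. *)
Fixpoint iterated_integral d (E : measurableType d) (nu : set E -> \bar R)
    (D : seq (set E)) (F : seq E -> \bar R) : \bar R :=
  if D is A :: D' then
    (\int[nu]_(x in A) iterated_integral nu D' (fun z => F (x :: z)))%E
  else F [::].

Definition kernel_det (E : Type) (K : E -> E -> R) (z : seq E) : R :=
  \det (\matrix_(i < size z, j < size z)
          K (tnth (in_tuple z) i) (tnth (in_tuple z) j)).

(** The points [X i], [i : I], form a determinantal point process on [E] with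
    kernel [K] and reference measure [nu]: for every [k] the [k]-th factorial
    moment measure (the expected number of [k]-tuples of distinct points in
    [D_1 * ... * D_k]) has density [det (K (z_i, z_j))]. *)
Definition determinantal d (O : measurableType d) (P : probability O R)
    d' (E : measurableType d') (nu : set E -> \bar R) (K : E -> E -> R)
    (I : choiceType) (X : I -> O -> E) :=
  forall D : seq (set E), (forall A, A \in D -> measurable A) ->
    (\int[P]_w counting
       [set v : (size D).-tuple I | uniq v /\
          forall i : 'I_(size D), tnth (in_tuple D) i (X (tnth v i) w)] =
     iterated_integral nu D (fun z => (kernel_det K z)%:E))%E.

End probability_notions.

Section airy.
Variable R : realType.

(** The improper Riemann integral of [cos (t^3/3 + x t) / pi] over
    [0, +oo[, which converges only conditionally. *)
Definition Ai (x : R) : R :=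
  lim ((fun T : R => pi^-1 *
    \int[lebesgue_measure]_(t in `[0, T]) cos (t ^+ 3 / 3 + x * t)) @ +oo).

(** The arguments are (time, position) pairs. *)
Definition extended_airy_kernel (p q : R * R) : R :=
  let: (s, x) := p in let: (t, y) := q in
  if t <= s then
    \int[lebesgue_measure]_(l in `[0, +oo[)
      (expR (- l * (s - t)) * Ai (x + l) * Ai (y + l))
  else
    - \int[lebesgue_measure]_(l in `]-oo, 0])
      (expR (- l * (s - t)) * Ai (x + l) * Ai (y + l)).

(** Counting measure on the finite set of times [ts], times Lebesgue measure. *)
Definition times_lebesgue (ts : seq R) : set (R * R) -> \bar R :=
  (msum (fun i => dirac (nth 0%R ts i)) (size ts) \x lebesgue_measure)%E.

(** [A i] is the line A_i for [1 <= i]; [A 0] is unused. *)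
Definition airy_line_ensemble d (O : measurableType d) (P : probability O R)
    (A : nat -> O -> cspace R R) :=
  [/\ (forall i, (1 <= i)%N -> measurable_fun setT (A i)),
  {ae P, forall w, forall (i : nat) (x : R), (1 <= i)%N ->
      A i.+1 w x < A i w x} &
  (forall ts : seq R, uniq ts ->
     determinantal P (times_lebesgue ts) extended_airy_kernel
       (fun (li : 'I_(size ts) * nat) w =>
          let t := tnth (in_tuple ts) li.1 in
          (t, A li.2.+1 w t + t ^+ 2)))].

(** f[(x,k) -> (y,m)], for [x <= y] and [1 <= m <= k]. *)
Definition last_passage (f : nat -> R -> R) (x : R) (k : nat) (y : R) (m : nat) :
    R :=
  sup [set \sum_(m <= i < k.+1) (f i (s i.-1) - f i (s i)) |
        s in [set s : nat -> R | [/\ s k = x, s m.-1 = y &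
                forall i, (m <= i <= k)%N -> s i <= s i.-1]]].

Definition airy_sheet d (O : measurableType d) (P : probability O R)
    (S : O -> cspace R (R * R)%type) :=
  [/\ measurable_fun setT S,
   (forall c : R, same_law P P (diagonal_shift c \o S) S) &
   exists (d' : measure_display) (O' : measurableType d')
    (P' : probability O' R) (S' : O' -> cspace R (R * R)%type)
    (A : nat -> O' -> cspace R R),
  [/\ measurable_fun setT S',
      same_law P' P S' S,
      airy_line_ensemble P' A,
      {ae P', forall w, forall y : R, S' w (0, y) = A 1%N w y} &
      {ae P', forall w, forall x y z : rat, 0 < x ->
        exists K : nat, forall k : nat, (K <= k)%N ->
          let xk := - Num.sqrt (k%:R / (2 * ratr x)) in
          S' w (ratr x, ratr z) - S' w (ratr x, ratr y) =
          last_passage (fun i => A i w) xk k (ratr z) 1 -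
          last_passage (fun i => A i w) xk k (ratr y) 1}]].

End airy.

(* Main.v *)
Require Import Defs.
From HB Require Import structures.
From mathcomp Require Import all_boot all_order all_algebra finmap.
From mathcomp Require Import all_classical all_reals all_analysis.
From mathcomp Require Import measurable_realfun.
From mathcomp Require Import lra.
Import Order.TTheory GRing.Theory Num.Theory.
Import numFieldNormedType.Exports.
Local Open Scope classical_set_scope.
Local Open Scope ring_scope.
Set Implicit Arguments.
Unset Strict Implicit.
Unset Printing Implicit Defensive.

(** An additive path [(x, y) |-> f x + g y] has zero mixed difference over every
    rectangle. So absolute continuity would force, for all [x >= a], [y >= b],
    [S (x, y) - S (x, b) - S (a, y) + S (a, b) = 0] almost surely
    ([mixed_difference_eq0]). The parabola carried by the Airy sheet forbids it.
    By invariance under diagonal shifts, [T (x, y) := S (x, y) + (y - x)^2] has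
    the law of [A_1 (t) + t^2] with [t = y - x] ([airy_sheet_marginal]), and these
    laws are tight uniformly in [t] ([parabolic_top_tight]). But a vanishing mixed
    difference of [S] reads
    [T (x, b) + T (a, y) - T (x, y) - T (a, b) = 2 (x - a) (y - b)], and the right
    side exceeds any bound when the rectangle grows.

    Uniform tightness needs no asymptotics of the Airy function. At a single time
    the extended kernel does not depend on the time, so the mean number
    [airy_intensity E] of points of the ensemble in [E] does not either. Two
    inequalities then bound the tails of the top point. Above [M], the first moment
    bounds [P (top > M)] by the intensity above [M]. Below [M], the determinantal
    structure makes the variance of the number of points in [E] at most its mean,
    so Chebyshev's inequality gives [P (no point in E) * airy_intensity E <= 1]
    ([determinantal_void_bound]), which applies to [top <= M] when [E] lies in
    the half-line above [M]. The ensemble has infinitely many lines, so the total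
    intensity is infinite and the second bound controls the lower tail. The
    intensity of some right half-line is finite, since otherwise the second bound
    would give [P (top <= M) = 0] for every [M]; the first bound then controls the
    upper tail. *)

(** * Integrals of functions that need not be measurable *)

Lemma lebesgue_measure_shift (R : realType) (c : R) (A : set R) :
  measurable A ->
  pushforward lebesgue_measure ((fun x => x + c) : _ -> measurableTypeR R) A =
  lebesgue_measure A.
Proof.
have mc : measurable_fun [set: measurableTypeR R]
    ((fun x => x + c) : measurableTypeR R -> measurableTypeR R).
  exact: measurable_funD.
move=> mA; apply/esym/lebesgue_measure_unique => //= _ [[u v] _ <-].
rewrite /pushforward (_ : _ @^-1` _ = `](u - c), (v - c)]%classic); last first.
  by apply/seteqP; split=> x /=; rewrite !in_itv/=; lra.
rewrite !lebesgue_measure_itv/= !lte_fin ltrBDr subrK; case: ifP => // _.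
by rewrite -!EFinD; congr (_%:E); lra.
Qed.

Section nonmeasurable_integral.
(* The integral of a nonnegative function is a supremum over the simple functions
   below it, whether the function is measurable or not. This avoids a study of the
   oscillatory limit that defines the Airy function. *)
Local Open Scope ereal_scope.
Import HBNNSimple.

Lemma le_integral_ge0r d (T : measurableType d) (R : realType)
    (mu : {measure set T -> \bar R}) (D : set T) (f g : T -> \bar R) :
  (forall x, D x -> 0 <= g x) -> (forall x, D x -> f x <= g x) ->
  \int[mu]_(x in D) f x <= \int[mu]_(x in D) g x.
Proof.
move=> g0 fg; rewrite integralE.
have fneg : 0 <= \int[mu]_(x in D) f^\- x by exact: integral_ge0.
apply: (@le_trans _ _ (\int[mu]_(x in D) f^\+ x)).
  by rewrite -[leRHS]sube0; apply: leeB.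
rewrite !ge0_integralE//; apply: ereal_sup_le => _ [h hf <-].
exists h => // x.
apply: le_trans (hf x) _; rewrite !patchE; case: ifPn => // /[!inE] Dx.
by rewrite funeposE ge_max fg// g0.
Qed.

(** A simple function below [g (y + _)] on the half-line becomes, after a shift by
    [y - x] to the right, a simple function below [g (x + _)] with the same
    integral. *)
Lemma le_integral_shift (R : realType) (g : R -> R) (x y : R) :
  (forall z, 0 <= g z)%R -> (x <= y)%R ->
  \int[lebesgue_measure]_(l in `[0%R, +oo[) (g (y + l)%R)%:E <=
  \int[lebesgue_measure]_(l in `[0%R, +oo[) (g (x + l)%R)%:E.
Proof.
move=> g0 xy.
rewrite !ge0_integralE//; try by move=> ? _; rewrite lee_fin.
apply: ereal_sup_le => _ [h hg <-].
pose tau : measurableTypeR R -> measurableTypeR R := fun l => (l + (x - y))%R.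
have mtau : measurable_fun setT tau by exact: measurable_funD.
have mh : measurable_fun setT (h \o tau) by exact: measurableT_comp.
have fh : finite_set (range (h \o tau)).
  by apply: sub_finite_set (fimfunP h) => _ [z _ <-]; exists (tau z).
have nh z : (0 <= (h \o tau) z)%R by exact: fun_ge0.
pose m1 := isMeasurableFun.Build _ _ _ _ _ mh.
pose m2 := @FiniteImage.Build _ _ _ fh.
pose m3 := @isNonNegFun.Build _ _ _ nh.
pose k : {nnsfun _ >-> _} := HB.pack (h \o tau) m1 m2 m3.
exists k => [l /=|].
  apply: le_trans (hg _) _.
  rewrite /tau !patchE !mem_setE !in_itv/= !andbT.
  have -> : (y + (l + (x - y)) = x + l)%R by lra.
  case: ifPn => [l0|_]; last by case: ifPn => //; rewrite lee_fin.
  by rewrite ifT//; apply: le_trans l0 _; lra.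
have eq_level r : lebesgue_measure (k @^-1` [set r]) =
    lebesgue_measure (h @^-1` [set r]).
  rewrite -[RHS](lebesgue_measure_shift (x - y))//.
  exact: (measurable_funPTI h).
exact: (congr1 (fun m : R -> \bar R => \sum_(r \in [set: R]) (r%:E * m r))
  (funext eq_level)).
Qed.

End nonmeasurable_integral.

Lemma nonincreasing_emeasurable (R : realType) (f : R -> \bar R) :
  (forall x y, x <= y -> (f y <= f x)%E) -> measurable_fun setT f.
Proof.
move=> f_ni _.
apply: (measurability _ (ErealGenCInfty.measurableE R)) => //= _ [_ [r ->]] <-.
rewrite setTI; apply: is_interval_measurable => s t /=.
rewrite !in_itv/= !andbT => _ ft u /andP[_ ut].
by rewrite in_itv/= andbT (le_trans ft)// f_ni.
Qed.

(** * The one-time Airy kernel *)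

Section airy_density.
Variable R : realType.

Definition airy_density (x : R) : R :=
  \int[lebesgue_measure]_(l in `[0, +oo[) Ai (x + l) ^+ 2.

Lemma extended_airy_kernel_diag (t x : R) :
  extended_airy_kernel (t, x) (t, x) = airy_density x.
Proof.
rewrite /extended_airy_kernel lexx /airy_density; congr (fine _).
by apply: eq_integral => l _; rewrite subrr mulr0 expR0 mul1r expr2.
Qed.

Lemma extended_airy_kernel_sym (t x y : R) :
  extended_airy_kernel (t, x) (t, y) = extended_airy_kernel (t, y) (t, x).
Proof.
rewrite /extended_airy_kernel lexx; apply: eq_Rintegral => l _.
by rewrite mulrAC.
Qed.

Lemma airy_density_ge0 x : 0 <= airy_density x.
Proof.
by apply: fine_ge0; apply: integral_ge0 => l _; rewrite lee_fin sqr_ge0.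
Qed.

(** As an extended real number the integral is nonincreasing in [x], because it is
    the integral of [Ai ^+ 2] over the half-line from [x]. *)
Lemma measurable_airy_density : measurable_fun setT airy_density.
Proof.
pose G (x : R) :=
  (\int[lebesgue_measure]_(l in `[0%R, +oo[) (Ai (x + l) ^+ 2)%:E)%E.
have G_mono x y : x <= y -> (G y <= G x)%E.
  by apply: (@le_integral_shift R (fun z => Ai z ^+ 2)) => z; exact: sqr_ge0.
have mG : measurable_fun setT G by exact: nonincreasing_emeasurable.
exact: (measurableT_comp (fine_measurable measurableT) mG).
Qed.

End airy_density.

(** Lebesgue measure on [R] with its canonical measurable structure, which is the
    one used in the product [R * R]. The library's [lebesgue_measure] lives on a
    copy of [R] with the same measurable sets but another display. *)
Definition lebesgue_borel (R : realType) : set R -> \bar R := lebesgue_measure.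

HB.instance Definition _ (R : realType) :=
  isMeasure.Build _ R R (@lebesgue_borel R)
    (measure0 (@lebesgue_measure R)) (measure_ge0 (@lebesgue_measure R))
    (@measure_semi_sigma_additive _ _ _ (@lebesgue_measure R)).

HB.instance Definition _ (R : realType) :=
  @Measure_isSigmaFinite.Build _ R R (@lebesgue_borel R)
    (sigma_finiteT (@lebesgue_measure R)).

Section airy_intensity.
Variable R : realType.
Local Open Scope ereal_scope.

Definition airy_intensity (E : set R) : \bar R :=
  \int[@lebesgue_borel R]_(x in E) (airy_density x)%:E.

Lemma times_lebesgue1 (t : R) :
  times_lebesgue [:: t] = (\d_t \x @lebesgue_borel R).
Proof.
apply/funext => A; rewrite /times_lebesgue /product_measure1.
congr (integral _ _ _); apply/funext => B.
by rewrite /msum big_ord1.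
Qed.

(** This is where the time [t] disappears. *)
Lemma airy_intensityE (t : R) (E : set R) : measurable E ->
  \int[\d_t \x @lebesgue_borel R]_(z in [set t] `*` E) (airy_density z.2)%:E =
  airy_intensity E.
Proof.
move=> mE.
have mtE : measurable ([set t] `*` E) by apply: measurableX.
have mk : measurable_fun setT (fun z : R * R => (airy_density z.2)%:E).
  apply/measurable_EFinP; apply: measurableT_comp measurable_snd.
  exact: measurable_airy_density.
rewrite integral_mkcond; set f := _ \_ _.
have f0 z : 0 <= f z.
  by rewrite /f patchE; case: ifP => // _; rewrite lee_fin airy_density_ge0.
have mf : measurable_fun setT f.
  by apply/measurable_restrict => //; exact: measurable_funTS.
rewrite fubini_tonelli1// integral_dirac//; last first.
  exact: measurable_fun_fubini_tonelli_F.
rewrite diracE in_setT mul1e /fubini_F /airy_intensity [RHS]integral_mkcond.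
apply: eq_integral => x _; rewrite !patchE; congr (if _ then _ else _).
by rewrite in_setX/= mem_set.
Qed.

Lemma airy_intensity_ge0 (E : set R) : 0 <= airy_intensity E.
Proof. by apply: integral_ge0 => x _; rewrite lee_fin airy_density_ge0. Qed.

Let measurable_density (E : set R) :
  measurable_fun E (fun x => (@airy_density R x)%:E).
Proof.
apply/measurable_EFinP; apply: measurable_funTS.
exact: measurable_airy_density.
Qed.

Lemma airy_intensityU (E F : set R) : measurable E -> measurable F ->
  [disjoint E & F] ->
  airy_intensity (E `|` F) = airy_intensity E + airy_intensity F.
Proof.
move=> mE mF EF; rewrite /airy_intensity ge0_integral_setU//.
by move=> x _; rewrite lee_fin airy_density_ge0.
Qed.

Lemma le_airy_intensity (E F : set R) : measurable E -> measurable F ->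
  E `<=` F -> airy_intensity E <= airy_intensity F.
Proof.
move=> mE mF EF; rewrite /airy_intensity; apply: ge0_subset_integral => //.
by move=> x _; rewrite lee_fin airy_density_ge0.
Qed.

(** The sets where [|x| <= n] and the density is at most [n] have finite intensity
    and increase to the whole line. The bound on [F] serves the tail estimates: it
    puts [F] inside, or away from, a far half-line. *)
Lemma airy_intensity_exhaust (E : set R) (c : R) : measurable E ->
  c%:E < airy_intensity E ->
  exists (n : nat) (F : set R), [/\ measurable F, F `<=` E,
    F `<=` `[(- n%:R)%R, n%:R%R]%classic, c%:E < airy_intensity F &
    airy_intensity F < +oo].
Proof.
move=> mE cE.
pose F n : set R := E `&` [set` `[(- n%:R)%R, n%:R%R]] `&`
  [set x | (airy_density x <= n%:R)%R].
have mF n : measurable (F n).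
  apply: measurableI; first exact: measurableI.
  rewrite -[X in measurable X]setTI; apply: measurable_fun_le => //.
    exact: measurable_airy_density.
have ndF : nondecreasing_seq F.
  move=> m n mn; apply/subsetPset => x [[Ex /=]].
  rewrite !in_itv/= => /andP[xm mx] km.
  have mnR : (m%:R <= n%:R :> R)%R by rewrite ler_nat.
  split; last exact: le_trans km mnR.
  split => //=; rewrite in_itv/= (le_trans mx)// andbT.
  by apply: le_trans xm; rewrite lerN2.
have UF : \bigcup_n F n = E.
  apply/seteqP; split => [x [n _ [[Ex _] _]]//|x Ex].
  have [n xn] : exists n : nat, (`|x| + airy_density x <= n%:R)%R.
    exists (Num.truncn (`|x| + airy_density x)).+1; apply/ltW/truncnS_gt.
  have kx := airy_density_ge0 x; have nx := normr_ge0 x.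
  exists n => //; split => /=; last lra.
  split => //=; rewrite in_itv/= -ler_norml; lra.
have cvgF : airy_intensity (F n) @[n --> \oo] --> airy_intensity E.
  rewrite -UF; apply: ge0_nondecreasing_set_cvg_integral => //.
  by move=> n x _; rewrite lee_fin airy_density_ge0.
have [n cn] : exists n, c%:E < airy_intensity (F n).
  apply/not_existsP => cF; move: cE; apply/negP; rewrite -leNgt.
  apply: (cvge_le _ cvgF).
  by apply: nearW => n; rewrite leNgt; apply/negP/cF.
exists n, (F n); split => //; [by move=> x [[]]|by move=> x [[]]|].
apply: (@le_lt_trans _ _ (\int[@lebesgue_borel R]_(x in F n) (cst n%:R%:E) x)).
  by apply: le_integral_ge0r => // x [_ /=].
rewrite integral_cst; last exact: mF.
apply: lte_mul_pinfty; [by rewrite lee_fin|by []|].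
apply: (@le_lt_trans _ _
  (@lebesgue_borel R (`[(- n%:R)%R, n%:R%R]%classic : set R))).
  apply: le_measure; rewrite ?inE; [exact: mF|exact: measurable_itv|].
  by move=> x [[]].
rewrite /lebesgue_borel lebesgue_measure_itv/=; case: ifP => // _.
by rewrite -EFinB ltry.
Qed.

End airy_intensity.

(** * Counting tuples of distinct points *)

(** The number of these tuples is the falling factorial [n (n - 1) ... (n - k + 1)]
    when [Q] has [n] elements; its mean is the [k]-th factorial moment. *)
Definition distinct_tuples (I : choiceType) (k : nat) (Q : set I) :
    set (k.-tuple I) :=
  [set v : k.-tuple I | uniq v /\ forall i, Q (tnth v i)].
Arguments distinct_tuples {I} k Q _.

Section counting_tuples.
Variable R : realType.
Local Open Scope ereal_scope.

Lemma counting_ge0 (T : choiceType) (A : set T) : 0 <= counting A :> \bar R.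
Proof. by rewrite /counting; case: ifP => // _; rewrite lee_fin. Qed.

Lemma counting_seq (T : choiceType) (s : seq T) : uniq s ->
  counting [set` s] = (size s)%:R%:E :> \bar R.
Proof.
move=> us; have fs : finite_set [set` s] by apply/finite_seqP; exists s.
rewrite /counting asboolT//; congr (_%:R%:E).
have -> : [set` s] = [set` [fset x in s]%fset].
  by apply/seteqP; split => x /=; rewrite inE.
by rewrite set_fsetK card_fseq undup_id.
Qed.

Lemma counting_ge_size (T : choiceType) (s : seq T) (A : set T) : uniq s ->
  [set` s] `<=` A -> (size s)%:R%:E <= counting A :> \bar R.
Proof.
move=> us sA; have [fA|iA] := pselect (finite_set A); last first.
  by rewrite /counting asboolF// leey.
have fs : finite_set [set` s] by apply/finite_seqP; exists s.
rewrite -counting_seq// /counting !asboolT// lee_fin ler_nat.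
by apply: fsubset_leq_card; rewrite -fset_set_sub.
Qed.

Lemma counting_distinct1 (I : choiceType) (s : seq I) : uniq s ->
  counting (distinct_tuples 1 [set` s]) = (size s)%:R%:E :> \bar R.
Proof.
move=> us; rewrite -(size_map (fun x => [tuple x])) -counting_seq; last first.
  by rewrite map_inj_uniq// => x y [].
congr counting; apply/seteqP; split => [v [_ /(_ ord0)/= vs]|_ /mapP[x xs ->]] /=.
  apply/mapP; exists (tnth v ord0) => //; apply/val_inj => /=.
  by case: v vs => -[|x []].
by split => // i; rewrite ord1.
Qed.

Lemma counting_distinct2 (I : choiceType) (s : seq I) : uniq s ->
  (size s * (size s).-1)%:R%:E <=
  counting (distinct_tuples 2 [set` s]) :> \bar R.
Proof.
move=> us; pose t := [seq [tuple x; y] | x <- s, y <- rem x s].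
have <- : size t = (size s * (size s).-1)%N.
  rewrite size_allpairs_dep sumnE big_map big_seq.
  rewrite (eq_bigr (fun=> (size s).-1)); last by move=> x xs; rewrite size_rem.
  by rewrite -big_seq big_const_seq count_predT iter_addn_0 mulnC.
apply: counting_ge_size.
  apply: allpairs_uniq_dep => //; first by move=> x _; exact: rem_uniq.
  by move=> [x y] [x' y'] _ _ /= [-> ->].
move=> v /allpairsPdep[x [y [xs]]]; rewrite mem_rem_uniq// inE => /andP[yx ys] ->.
split => [|i /=]; first by rewrite /= inE eq_sym yx.
by case: i => -[|[|]].
Qed.

(** The pointwise form of Chebyshev's inequality at zero: if [Q] has [n] elements,
    this is [m^2 1_{n = 0} <= (n - m)^2]. The square is expanded and [n^2] is
    written [n (n - 1) + n], so that both sides are sums of nonnegative terms and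
    also make sense when [Q] is infinite. *)
Lemma counting_second_moment_bound (I : choiceType) (Q : set I) (m : R) :
  (0 <= m)%R ->
  (m ^+ 2 * (Q == set0)%:R)%:E + (2 * m)%:E * counting (distinct_tuples 1 Q) <=
  counting (distinct_tuples 2 Q) + counting (distinct_tuples 1 Q) +
  (m ^+ 2)%:E.
Proof.
move=> m0; have [/finite_seqP[s' ->]|iQ] := pselect (finite_set Q).
  have [s us ->] : exists2 s, uniq s & [set` s'] = [set` s].
    exists (undup s'); first exact: undup_uniq.
    by apply/seteqP; split => x /=; rewrite mem_undup.
  have N2 := counting_distinct2 us.
  rewrite counting_distinct1//; apply: le_trans (leeD (leeD N2 (lexx _)) (lexx _)).
  rewrite -EFinM -!EFinD lee_fin natrM.
  case: s {us N2} => [|x s].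
    have -> : [set` [::]] = set0 :> set I by apply/seteqP; split.
    by rewrite eqxx/=; nra.
  rewrite (_ : (_ == set0) = false) ?mulr0 ?add0r /=; last first.
    by apply/negbTE/set0P; exists x => /=; rewrite inE eqxx.
  rewrite -natr1; have := sqr_ge0 ((size s)%:R + 1 - m : R); nra.
rewrite [X in _ + X + _](_ : _ = +oo).
  rewrite addey ?addye ?leey//.
  by rewrite gt_eqF// (lt_le_trans ltNy0)// counting_ge0.
rewrite /counting asboolF// => /finite_seqP[s sE]; apply: iQ.
apply/finite_seqP; exists (map (fun v : 1.-tuple I => tnth v ord0) s).
apply/seteqP; split => x /=.
  move=> Qx; apply/mapP; exists [tuple x] => //.
  suff : [set` s] [tuple x] by [].
  by rewrite -sE; split => // i; rewrite ord1.
by move=> /mapP[v vs ->]; have : [set` s] v by []; rewrite -sE => -[_].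
Qed.

Lemma counting_pickle (I : countType) (Q : set I) :
  counting (choice.pickle @` Q) = counting Q :> \bar R.
Proof.
have [/finite_seqP[s' ->]|iQ] := pselect (finite_set Q).
  have -> : [set` s'] = [set` undup s'].
    by apply/seteqP; split => x /=; rewrite mem_undup.
  have inj : injective (@choice.pickle I) by exact: pcan_inj choice.pickleK.
  rewrite counting_seq ?undup_uniq// -(size_map choice.pickle) -counting_seq; last first.
    by rewrite map_inj_uniq// undup_uniq.
  congr counting; apply/seteqP; split => [_ [x xs <-]|_ /mapP[x xs ->]] /=.
    by apply/mapP; exists x.
  by exists x.
rewrite /counting !asboolF// => /finite_seqP[t tE]; apply: iQ.
apply/finite_seqP; exists (pmap choice.unpickle t); apply/seteqP; split => x /=.
  move=> Qx; rewrite mem_pmap; apply/mapP; exists (choice.pickle x).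
    by suff : [set` t] (choice.pickle x) by []; rewrite -tE; exists x.
  by rewrite choice.pickleK.
rewrite mem_pmap => /mapP[n nt xn]; have : [set` t] n by [].
by rewrite -tE => -[y Qy yn]; move: xn; rewrite -yn choice.pickleK => -[->].
Qed.

(** Transporting the count to [nat] turns it into a series of indicators. *)
Lemma measurable_counting d (O : measurableType d) (I : countType)
    (Q : O -> set I) : (forall i, measurable [set w | Q w i]) ->
  measurable_fun setT (fun w => counting (Q w) : \bar R).
Proof.
move=> mQ.
under eq_fun do rewrite -counting_pickle counting_dirac.
apply: ge0_emeasurable_sum => // n _.
have -> : (fun w => \d_n (choice.pickle @` Q w)) =
    EFin \o \1_[set w | (choice.pickle @` Q w) n] :> (O -> \bar R).
  by apply/funext => w; rewrite diracE /= indicE; congr (_%:R%:E).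
apply/measurable_EFinP; apply: measurable_indic.
case E : (pickle_inv n) (@pickle_invK I n) => [i|] /= => [<-|_].
  rewrite (_ : mkset _ = [set w | Q w i])//; apply/seteqP; split => w /=.
    by move=> [j Qj /(pcan_inj choice.pickleK) <-].
  by exists i.
rewrite (_ : mkset _ = set0)//; apply/seteqP; split => w //=.
by move=> [i _ ni]; move: E; rewrite -ni pickleK_inv.
Qed.

End counting_tuples.

(** * The void probability of a determinantal process *)

Section kernel_det.
Variable R : realType.

Lemma kernel_det1 (E : Type) (K : E -> E -> R) x : kernel_det K [:: x] = K x x.
Proof. by rewrite /kernel_det det_mx11 mxE. Qed.

Lemma kernel_det2 (E : Type) (K : E -> E -> R) x y :
  kernel_det K [:: x; y] = K x x * K y y - K x y * K y x.
Proof.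
rewrite /kernel_det (expand_det_row _ ord0) !big_ord_recl big_ord0 /cofactor /=.
by rewrite !det_mx11 !mxE/= expr0 expr1 addr0 mul1r mulN1r mulrN.
Qed.

End kernel_det.

Section void_bound.
Local Open Scope ereal_scope.
Context (R : realType) d (O : measurableType d) (P : probability O R)
  d' (E : measurableType d')
  (nu : {measure set E -> \bar R}) (K : E -> E -> R) (I : countType)
  (X : I -> O -> E) (A : set E).
Hypotheses (detX : determinantal P nu K X)
  (mX : forall i, measurable_fun setT (X i)) (mA : measurable A).

Let N k w : \bar R := counting (distinct_tuples k [set i | A (X i w)]).

Let N_ge0 k w : 0 <= N k w.
Proof. exact: counting_ge0. Qed.

Let measurable_N k : measurable_fun setT (N k).
Proof.
apply: measurable_counting => v.
have [uv|nuv] := boolP (uniq v); last first.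
  rewrite (_ : mkset _ = set0)//; apply/seteqP; split => w //= -[uv].
  by rewrite uv in nuv.
rewrite (_ : mkset _ = \bigcap_(i in [set: 'I_k]) (X (tnth v i) @^-1` A));
    last first.
  apply/seteqP; split => w /= => [[_ h] i _|h]; first exact: h.
  by split => // i; exact: h.
apply: fin_bigcap_measurable => // i _.
by rewrite -[X in measurable X]setTI; exact: mX.
Qed.

Lemma measurable_void : measurable [set w | forall i, ~ A (X i w)].
Proof.
rewrite (_ : mkset _ = ~` \bigcup_i (X i @^-1` A)); last first.
  by rewrite setC_bigcup; apply/seteqP; split => w h i => [_|]; exact: h.
apply/measurableC/countable_bigcupT_measurable => // i.
by rewrite -[X in measurable X]setTI; exact: mX.
Qed.

Lemma determinantal_mean :
  \int[P]_w counting (distinct_tuples 1 [set i | A (X i w)]) =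
  \int[nu]_(x in A) (K x x)%:E.
Proof.
have mD D : D \in [:: A] -> measurable D by rewrite mem_seq1 => /eqP ->.
transitivity (\int[nu]_(x in A) (kernel_det K [:: x])%:E); last first.
  by apply: eq_integral => x _; rewrite kernel_det1.
rewrite -[RHS](detX mD); apply: eq_integral => w _; congr counting.
by apply/seteqP; split => v [uv h]; split => // i; have := h i; rewrite [i]ord1.
Qed.

Hypotheses (symK : forall x y, A x -> A y -> K x y = K y x)
  (K_ge0 : forall x, A x -> (0 <= K x x)%R)
  (mK : measurable_fun A (fun x => K x x)).

Let m := \int[nu]_(x in A) (K x x)%:E.

(* The determinant of order two is [K x x * K y y - K x y ^+ 2] by symmetry. *)
Let pair_moment_le : m < +oo -> \int[P]_w N 2 w <= m * m.
Proof.
move=> moo.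
have m0 : 0 <= m by apply: integral_ge0 => x Ax; rewrite lee_fin K_ge0.
have mD D : D \in [:: A; A] -> measurable D by rewrite !inE => /orP[] /eqP ->.
have -> : \int[P]_w N 2 w =
    \int[nu]_(x in A) \int[nu]_(y in A) (kernel_det K [:: x; y])%:E.
  rewrite -[RHS](detX mD); apply: eq_integral => w _; congr counting.
  by apply/seteqP; split => v [uv h]; split => // -[[|[|//]] i2];
    have := h (Ordinal i2).
have mulm c : (0 <= c)%R -> \int[nu]_(x in A) (c%:E * (K x x)%:E) = c%:E * m.
  move=> c0; rewrite ge0_integralZl_EFin//; last exact/measurable_EFinP.
apply: (@le_trans _ _ (\int[nu]_(x in A) (m * (K x x)%:E))).
  apply: le_integral_ge0r => x Ax.
    by apply: mule_ge0 => //; rewrite lee_fin K_ge0.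
  rewrite muleC -mulm ?K_ge0//; apply: le_integral_ge0r => y Ay.
    by rewrite -EFinM lee_fin mulr_ge0 ?K_ge0.
  rewrite kernel_det2 -EFinM lee_fin (symK Ay Ax).
  by rewrite lerBlDr lerDl -expr2 sqr_ge0.
have mfin : m \is a fin_num by rewrite ge0_fin_numE.
by have := mulm _ (fine_ge0 m0); rewrite fineK// => ->.
Qed.

(** Chebyshev's inequality for the number of points in [A], whose variance is at
    most its mean [m] because its second factorial moment is at most [m * m]. *)
Lemma determinantal_void_bound : m < +oo ->
  P [set w | forall i, ~ A (X i w)] * m <= 1.
Proof.
move=> moo; set V := mkset _.
have m0 : 0 <= m by apply: integral_ge0 => x Ax; rewrite lee_fin K_ge0.
have mV : measurable V := measurable_void.
have pfin : P V \is a fin_num by exact: fin_num_measure.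
have mfin : m \is a fin_num by rewrite ge0_fin_numE.
pose r := fine m; have r0 : (0 <= r)%R by exact: fine_ge0.
have mE : m = r%:E by rewrite fineK.
have : \int[P]_w ((r ^+ 2)%:E * (\1_V w)%:E + (2 * r)%:E * N 1 w) <=
    \int[P]_w (N 2 w + N 1 w + (r ^+ 2)%:E).
  apply: le_integral_ge0r => w _.
    by rewrite !adde_ge0// lee_fin sqr_ge0.
  have := counting_second_moment_bound [set i | A (X i w)] r0.
  rewrite -EFinM (_ : \1_V w = ([set i | A (X i w)] == set0)%:R :> R)//.
  rewrite indicE; congr ((nat_of_bool _)%:R); apply/idP/eqP; rewrite inE.
    by move=> Vw; apply/seteqP; split => i //=; exact: Vw.
  by move=> Q0 i Ai; suff : set0 i by []; rewrite -Q0.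
have m1V : measurable_fun setT (fun w => (\1_V w)%:E : \bar R).
  exact/measurable_EFinP/measurable_indic.
have mc (c : R) f : measurable_fun setT f ->
    measurable_fun setT (fun w : O => c%:E * f w).
  exact: measurable_funeM.
have c0 : (0 <= 2 * r)%R by rewrite mulr_ge0.
rewrite ge0_integralD//; first last.
- exact: mc.
- by move=> w _; rewrite mule_ge0.
- exact: mc.
- by move=> w _; rewrite mule_ge0// lee_fin sqr_ge0.
rewrite [X in _ <= X]ge0_integralD//; first last.
- by move=> w _; rewrite lee_fin sqr_ge0.
- exact: emeasurable_funD.
- by move=> w _; rewrite adde_ge0.
rewrite [X in _ <= X + _]ge0_integralD// !ge0_integralZl_EFin ?sqr_ge0//.
rewrite integral_indic// setIT integral_cst//.
have PT : P [set: O] = 1 by exact: probability_setT.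
rewrite [X in _ <= _ + _ * X]PT mule1.
rewrite determinantal_mean -/m => /le_trans H.
have {H} := H _ (leeD (leeD (pair_moment_le moo) (lexx _)) (lexx _)).
set p := fine (P V); have PV : P V = p%:E by rewrite fineK.
rewrite [X in _ * X + _ <= _](_ : _ = p%:E)// PV mE.
rewrite -!EFinM -!EFinD !lee_fin => rp.
have p0 : (0 <= p)%R by exact: fine_ge0.
have [->|rn0] := eqVneq r 0%R; first by rewrite mulr0.
have {}r0 : (0 < r)%R by rewrite lt_neqAle eq_sym rn0.
by rewrite -(ler_pM2l r0); nra.
Qed.

End void_bound.

(** * Tails of the top line at a fixed time *)

Section evaluation.
Variables (R : realType) (T : topologicalType).

Lemma open_eval_itv (x : T) (u v : R) :
  open ([set g | `]u, v[%classic (g x)] : set {compact-open, T -> R}).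
Proof.
rewrite (_ : mkset _ = [set g | g @` [set x] `<=` `]u, v[%classic]).
  by apply: compact_open_open; [exact: compact_set1|exact: interval_open].
by apply/seteqP; split => g /= => [h _ [_ -> <-]|]; [|apply; exists x].
Qed.

Lemma measurable_eval (x : T) :
  measurable_fun setT (fun f : cspace R T => f x).
Proof.
move=> _; apply: (measurability _ (RGenOpens.measurableE R)) => //=.
move=> _ [_ [u [v ->]] <-]; rewrite setTI; apply: sub_sigma_algebra.
by exists [set g | `]u, v[%classic (g x)] => //; exact: open_eval_itv.
Qed.

Lemma measurable_eval0 (p x : T) :
  measurable_fun setT (fun f : cspace0 R p => f x).
Proof.
move=> _; apply: (measurability _ (RGenOpens.measurableE R)) => //=.
move=> _ [_ [u [v ->]] <-]; rewrite setTI; apply: sub_sigma_algebra.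
by exists [set g | `]u, v[%classic (g x)] => //; exact: open_eval_itv.
Qed.

End evaluation.

Lemma measure_le_ae d (T : measurableType d) (R : realType)
    (mu : {measure set T -> \bar R}) (A B : set T) :
  measurable A -> measurable B -> {ae mu, forall x, A x -> B x} ->
  (mu A <= mu B)%E.
Proof.
move=> mA mB [N [mN N0 sN]].
apply: (@le_trans _ _ (mu (B `|` N))).
  apply: le_measure; rewrite ?inE//; first exact: measurableU.
  move=> x Ax; have [Bx|nBx] := pselect (B x); first by left.
  by right; apply: sN => /(_ Ax).
rewrite (le_trans (measureU2 mu mB mN))//.
by rewrite [X in (_ + X)%E](_ : _ = 0%E)// adde0.
Qed.

Section top_line.
Local Open Scope ereal_scope.
Context (R : realType) d (O : measurableType d) (P : probability O R)
  (A : nat -> O -> cspace R R).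
Hypothesis hA : airy_line_ensemble P A.

Definition parabolic_top (t : R) (w : O) : R := (A 1%N w t + t ^+ 2)%R.

Variable t : R.

Let nu := (\d_t \x @lebesgue_borel R).

(* Line [A_j] has index [j.-1], as the lines are numbered from 1. *)
Let X (li : 'I_1 * nat) (w : O) : R * R := (t, (A li.2.+1 w t + t ^+ 2)%R).

Let mX li : measurable_fun setT (X li).
Proof.
have [mA _ _] := hA.
apply/measurable_fun_pairP; split; first exact: measurable_cst.
apply: measurable_funD; last exact: measurable_cst.
exact: (measurableT_comp (measurable_eval t) (mA _ _)).
Qed.

Let detX : determinantal P nu (@extended_airy_kernel R) X.
Proof.
have [_ _ /(_ [:: t] isT)] := hA; rewrite times_lebesgue1.
set Y := (Y in determinantal _ _ _ Y); have -> : Y = X; last by [].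
by apply/funext => -[i j]; apply/funext => w; rewrite /X /Y /= [i]ord1.
Qed.

(* The points are looked for in the sets {t} x E, where the kernel is symmetric; it
   is not symmetric between different times. *)
Let mstrip (E : set R) : measurable E -> measurable ([set t] `*` E).
Proof. by move=> mE; apply: measurableX. Qed.

Let ae_le_top : {ae P, forall w i, (A i.+1 w t <= A 1%N w t)%R}.
Proof.
have [_ decA _] := hA; apply: filterS decA => w dec.
elim=> // i /(le_trans _); apply; exact/ltW/dec.
Qed.

Lemma measurable_parabolic_top : measurable_fun setT (parabolic_top t).
Proof.
have [mA _ _] := hA.
apply: measurable_funD; last exact: measurable_cst.
exact: (measurableT_comp (measurable_eval t) (mA _ _)).
Qed.

Lemma measurable_top_gt (M : R) :
  measurable [set w | (M < parabolic_top t w)%R].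
Proof.
rewrite (_ : mkset _ = setT `&` parabolic_top t @^-1` `]M, +oo[%classic).
  by apply: measurable_parabolic_top => //; exact: measurable_itv.
by apply/seteqP; split => w /=; rewrite in_itv/= andbT => //; case.
Qed.

Lemma measurable_top_le (M : R) :
  measurable [set w | (parabolic_top t w <= M)%R].
Proof.
rewrite (_ : mkset _ = ~` [set w | (M < parabolic_top t w)%R]).
  exact/measurableC/measurable_top_gt.
by apply/seteqP; split => w /=; rewrite leNgt => /negP.
Qed.

Let intensityE (E : set R) : measurable E ->
  \int[nu]_(z in [set t] `*` E) (extended_airy_kernel z z)%:E = airy_intensity E.
Proof.
move=> mE; rewrite -(airy_intensityE t mE); apply: eq_integral => -[s x] _.
by rewrite extended_airy_kernel_diag.
Qed.

Let meanE (E : set R) : measurable E ->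
  \int[P]_w counting (distinct_tuples 1 [set i | ([set t] `*` E) (X i w)]) =
  airy_intensity E.
Proof.
by move=> mE; rewrite (determinantal_mean detX)// ?intensityE//; exact: mstrip.
Qed.

(** Every one of the infinitely many lines is somewhere. *)
Lemma airy_intensityT : airy_intensity [set: R] = +oo.
Proof.
rewrite -meanE//.
rewrite (_ : (fun w => _) = cst +oo); last first.
  apply/funext => w; rewrite /counting asboolF// => /finite_seqP[s sE].
  suff : finite_set [set: nat] by exact: infinite_nat.
  apply/finite_seqP; exists [seq (tnth v ord0).2 | v <- s].
  apply/seteqP; split => // n _ /=; apply/mapP; exists [tuple (ord0, n)] => //.
  suff : [set` s] [tuple (ord0 : 'I_1, n)] by [].
  by rewrite -sE; split.
by rewrite integral_cst// [X in _ * X](@probability_setT _ _ _ P) mule1.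
Qed.

Lemma top_gt_le_intensity (M : R) :
  P [set w | (M < parabolic_top t w)%R] <= airy_intensity `]M, +oo[%classic.
Proof.
have mB := measurable_top_gt M.
rewrite -meanE// -[X in P X]setIT -integral_indic//.
apply: le_integral_ge0r => w _; first exact: counting_ge0.
rewrite indicE; have [|_] := boolP (w \in _); last first.
  exact: counting_ge0.
rewrite inE /= => Mw.
apply: (@le_trans _ _ (size [:: [tuple (ord0 : 'I_1, 0%N)]])%:R%:E) => //.
apply: counting_ge_size => // v /=; rewrite mem_seq1 => /eqP -> /=.
by split => // i; rewrite [i]ord1 /= in_itv/= andbT.
Qed.

(** If the top point is at most [M], then there is no point in [E]. *)
Lemma top_le_intensity (M : R) (E : set R) : measurable E ->
  E `<=` `]M, +oo[%classic -> airy_intensity E < +oo ->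
  P [set w | (parabolic_top t w <= M)%R] * airy_intensity E <= 1.
Proof.
move=> mE EM Eoo; have mtE := mstrip mE.
apply: (@le_trans _ _ (P [set w | forall i, ~ ([set t] `*` E) (X i w)] *
  airy_intensity E)).
  apply: lee_wpmul2r; first exact: airy_intensity_ge0.
  have mV : measurable [set w | forall i, ~ ([set t] `*` E) (X i w)].
    by apply: measurable_void.
  apply: measure_le_ae => //; first exact: measurable_top_le.
  apply: filterS ae_le_top => w le_top top_le [i j] [_ /= /EM].
  rewrite /= in_itv/= andbT ltNge => /negP; apply.
  by apply: le_trans top_le; rewrite lerD2r.
rewrite -intensityE// in Eoo *.
apply: (determinantal_void_bound detX) => //.
- by move=> [s x] [s' y] [/= -> _] [/= -> _]; exact: extended_airy_kernel_sym.
- by move=> [s x] _; rewrite extended_airy_kernel_diag airy_density_ge0.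
- rewrite (_ : (fun z => _) = @airy_density R \o snd); last first.
    by apply/funext => -[s x]; rewrite extended_airy_kernel_diag.
  apply: measurable_funTS; apply: measurableT_comp measurable_snd.
  exact: measurable_airy_density.
Qed.

Lemma top_le_inverse_intensity (M c : R) : (0 < c)%R ->
  c%:E < airy_intensity `]M, +oo[%classic ->
  P [set w | (parabolic_top t w <= M)%R] <= (c^-1)%:E.
Proof.
move=> c0 cI.
have [n [F [mF FM _ cF Foo]]] := airy_intensity_exhaust (measurable_itv _) cI.
rewrite -[leRHS]mul1e lee_pdivlMr//.
apply: le_trans (top_le_intensity mF FM Foo).
by apply: lee_wpmul2l => //; exact: ltW.
Qed.

End top_line.

Section tightness.
Local Open Scope ereal_scope.
Context (R : realType) d (O : measurableType d) (P : probability O R)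
  (A : nat -> O -> cspace R R).
Hypothesis hA : airy_line_ensemble P A.

(** Otherwise the top point would almost surely be above every [M]. *)
Lemma airy_intensity_right_finite :
  exists M : R, airy_intensity `]M, +oo[%classic < +oo.
Proof.
apply/not_existsP => infI.
have P0 (M : R) : P [set w | (parabolic_top A 0 w <= M)%R] = 0.
  apply/eqP; rewrite eq_le measure_ge0 andbT; apply/lee_addgt0Pr => e e0.
  rewrite add0e -[e]invrK; apply: (top_le_inverse_intensity hA).
    by rewrite invr_gt0.
  rewrite (_ : airy_intensity _ = +oo) ?ltry//; apply/eqP.
  by rewrite -leye_eq leNgt; apply/negP/infI.
have : P (\bigcup_n [set w | (parabolic_top A 0 w <= n%:R)%R]) = 0.
  apply: measure_negligible.
    by apply: bigcupT_measurable => n; exact: (measurable_top_le hA).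
  by apply: negligible_bigcup => n; apply/negligibleP;
    [exact: (measurable_top_le hA)|exact: P0].
rewrite (_ : \bigcup_n _ = setT); last first.
  apply/seteqP; split => // w _.
  exists (Num.truncn (parabolic_top A 0 w)).+1 => //=.
  exact/ltW/truncnS_gt.
by rewrite (@probability_setT _ _ _ P) => /eqP; rewrite onee_eq0.
Qed.

Lemma parabolic_top_tight (e : R) : (0 < e)%R -> exists C : R, forall t : R,
  P [set w | (C < parabolic_top A t w)%R] <= e%:E /\
  P [set w | (parabolic_top A t w <= - C)%R] <= e%:E.
Proof.
move=> e0.
have [M0 M0oo] := airy_intensity_right_finite.
have I0fin : airy_intensity `]M0, +oo[%classic \is a fin_num.
  by rewrite ge0_fin_numE// airy_intensity_ge0.
pose r := fine (airy_intensity `]M0, +oo[%classic).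
have rE : airy_intensity `]M0, +oo[%classic = r%:E by rewrite fineK.
(* Upper tail: a bounded set carries all but [e] of the intensity above [M0]. *)
have rI : (r - e)%:E < airy_intensity `]M0, +oo[%classic.
  by rewrite rE lte_fin; lra.
have [n [F [mF FM Fn cF Foo]]] := airy_intensity_exhaust (measurable_itv _) rI.
(* Lower tail: some bounded set has intensity above [e^-1]. *)
have eT : (e^-1)%:E < airy_intensity [set: R].
  by rewrite (airy_intensityT hA 0) ltry.
have [n' [F' [mF' _ Fn' cF' Foo']]] := airy_intensity_exhaust measurableT eT.
exists (Num.max (Num.max n%:R M0) (n'%:R + 1))%R => t.
set C := Num.max (Num.max _ _) _.
have [Cn CM Cn'] : [/\ (n%:R <= C)%R, (M0 <= C)%R & (n'%:R + 1 <= C)%R].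
  by rewrite /C !le_max !lexx !orbT.
split.
  apply: le_trans (top_gt_le_intensity hA t C) _.
  have Ffin : airy_intensity F \is a fin_num.
    by rewrite ge0_fin_numE// airy_intensity_ge0.
  rewrite -(leeD2lE _ _ Ffin) -airy_intensityU//.
    apply: (@le_trans _ _ r%:E).
      rewrite -rE; apply: le_airy_intensity => //; first exact: measurableU.
      move=> x [/FM//|/=]; rewrite !in_itv/= !andbT; exact: le_lt_trans.
    move: cF; rewrite -(fineK Ffin) lte_fin -EFinD lee_fin; lra.
  apply/disj_setPS => x [/Fn /=].
  by rewrite !in_itv/= andbT => /andP[_ xn] Cx; lra.
have FC : F' `<=` `](- C)%R, +oo[%classic.
  by move=> x /Fn' /=; rewrite !in_itv/= andbT => /andP[nx _]; lra.
rewrite -[e]invrK; apply: (top_le_inverse_intensity hA).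
  by rewrite invr_gt0.
by apply: lt_le_trans cF' _; exact: le_airy_intensity.
Qed.

End tightness.

(** * Marginals and mixed differences of the Airy sheet *)

Section airy_sheet_law.
Local Open Scope ereal_scope.
Context (R : realType).

Lemma measurable_cspace_event d (O : measurableType d) (T : topologicalType)
    (X : O -> cspace R T) (p : T) (D : set R) :
  measurable_fun setT X -> measurable D -> measurable [set w | D (X w p)].
Proof.
move=> mX mD; rewrite (_ : mkset _ = setT `&` (fun w => X w p) @^-1` D).
  by apply: (measurableT_comp (measurable_eval p) mX).
by rewrite setTI.
Qed.

(** The diagonal shift by [x] moves [(0, y - x)] to [(x, y)], and on the axis
    [x = 0] the sheet is the top line. *)
Lemma airy_sheet_marginal d (O : measurableType d) (P : probability O R)
    (S : O -> cspace R (R * R)%type) : airy_sheet P S ->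
  exists (d' : measure_display) (O' : measurableType d')
    (P' : probability O' R) (A : nat -> O' -> cspace R R),
    airy_line_ensemble P' A /\
    forall (x y : R) (D : set R), measurable D ->
      P [set w | D (S w (x, y))] = P' [set w | D (A 1%N w (y - x)%R)].
Proof.
case=> mS shiftS [d' [ O' [P' [S' [A] []]]]] mS' lawS' hA S'A _.
exists d', O', P', A; split => // x y D mD.
have mA : measurable_fun setT (A 1%N) by case: hA => + _ _; exact.
have mE : measurable [set f : cspace R (R * R)%type | D (f (0, y - x)%R)].
  exact: (@measurable_cspace_event _ _ _ id (0, y - x)%R).
have := shiftS x _ mE; rewrite -(lawS' _ mE) /pushforward.
rewrite (_ : _ @^-1` _ = [set w | D (S w (0 + x, y - x + x)%R)])//.
rewrite add0r subrK.
move=> ->; rewrite (_ : _ @^-1` _ = [set w | D (S' w (0, y - x)%R)]) //.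
have mD1 := measurable_cspace_event (0, y - x)%R mS' mD.
have mD2 := measurable_cspace_event (y - x)%R mA mD.
by apply/eqP; rewrite eq_le !measure_le_ae//; apply: filterS S'A => w /= ->.
Qed.

(** The set of paths on the quadrant whose mixed difference over the rectangle
    with opposite corners [(a, b)] and [(x, y)] is nonzero contains no additive
    path, whatever the paths [B w] and [B' w] are. The value at the corner is
    omitted in [mixed] below because it is zero. *)
Lemma mixed_difference_eq0 (a b : R)
    d (O : measurableType d) (P : probability O R)
    (S : O -> cspace R (R * R)%type)
    d' (O' : measurableType d') (P' : probability O' R)
    (B : O' -> cspace0 R (halfline_start a))
    (B' : O' -> cspace0 R (halfline_start b)) :
  absolutely_continuous
    (pushforward P (fun w => centred_path a b (S w)))
    (pushforward P' (fun w => additive_path (B w) (B' w))) ->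
  forall x y : R, (a <= x)%R -> (b <= y)%R ->
  P [set w | (S w (x, y) - S w (x, b) - S w (a, y) + S w (a, b) != 0)%R] = 0.
Proof.
move=> ac x y ax bY.
pose x' : halfline a := exist _ x (mem_set ax).
pose y' : halfline b := exist _ y (mem_set bY).
pose a' := halfline_start a; pose b' := halfline_start b.
pose mixed (f : cspace0 R (corner a b)) : R :=
  (f (x', y') - f (x', b') - f (a', y'))%R.
have mmixed : measurable_fun setT mixed.
  by apply: measurable_funB; [apply: measurable_funB|]; exact: measurable_eval0.
have mD : measurable (mixed @^-1` [set~ 0%R]).
  by rewrite -[X in measurable X]setTI; apply: mmixed => //; exact: measurableC.
have := ac _ mD; rewrite /pushforward.
rewrite (_ : _ @^-1` _ = set0); last first.
  apply/seteqP; split => // w /=; apply.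
  rewrite (_ : mixed _ =
    (B w x' + B' w y') - (B w x' + B' w b') - (B w a' + B' w y'))%R//.
  rewrite (cspace0_base (B w)) (cspace0_base (B' w)); lra.
rewrite measure0 => /(_ erefl) <-; congr (P _).
have centredE w : mixed (centred_path a b (S w)) =
    (S w (x, y) - S w (x, b) - S w (a, y) + S w (a, b))%R.
  rewrite (_ : mixed _ = (S w (x, y) - S w (a, b)) -
    (S w (x, b) - S w (a, b)) - (S w (a, y) - S w (a, b)))%R//; lra.
apply/seteqP; split => w; rewrite /preimage /= centredE => /eqP //.
Qed.

End airy_sheet_law.

Unset Implicit Arguments.

Theorem proposition4p3 (R : realType)
    (d : measure_display) (O : measurableType d) (P : probability O R)
    (S : O -> cspace R (R * R)%type) (hS : airy_sheet P S)
    (a b : R)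
    (d' : measure_display) (O' : measurableType d') (P' : probability O' R)
    (B : O' -> cspace0 R (halfline_start a))
    (B' : O' -> cspace0 R (halfline_start b))
    (hB : rate_two_brownian P' B) (hB' : rate_two_brownian P' B')
    (hBB' : independent P' B B') :
  ~ absolutely_continuous
      (pushforward P (fun w => centred_path a b (S w)))
      (pushforward P' (fun w => additive_path (B w) (B' w))).
Proof.
move=> /mixed_difference_eq0 mixed0.
have [d1 [Q [P1 [A [hA law]]]]] := airy_sheet_marginal hS.
have e0 : 0 < 8^-1 :> R by rewrite invr_gt0.
have [C tight] := parabolic_top_tight hA e0.
pose T x y w := S w (x, y) + (y - x) ^+ 2.
have mS : measurable_fun setT S by case: hS.
have gtE x y : [set w | C < T x y w] =
    [set w | `]C - (y - x) ^+ 2, +oo[%classic (S w (x, y))].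
  by apply/seteqP; split => w; rewrite /= in_itv/= andbT /T ltrBlDr.
have leE x y : [set w | T x y w <= - C] =
    [set w | `]-oo, - C - (y - x) ^+ 2]%classic (S w (x, y))].
  by apply/seteqP; split => w; rewrite /= in_itv/= /T lerBrDr.
have mgt x y : measurable [set w | C < T x y w].
  by rewrite gtE; apply: measurable_cspace_event => //; exact: measurable_itv.
have mle x y : measurable [set w | T x y w <= - C].
  by rewrite leE; apply: measurable_cspace_event => //; exact: measurable_itv.
have Pgt x y : (P [set w | (C < T x y w)%R] <= (8^-1)%:E)%E.
  rewrite gtE law; last exact: measurable_itv.
  have [+ _] := tight (y - x); congr (P1 _ <= _)%E.
  by apply/seteqP; split => w; rewrite /= in_itv/= andbT /parabolic_top ltrBlDr.
have Ple x y : (P [set w | (T x y w <= - C)%R] <= (8^-1)%:E)%E.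
  rewrite leE law; last exact: measurable_itv.
  have [_] := tight (y - x); congr (P1 _ <= _)%E.
  by apply/seteqP; split => w; rewrite /= in_itv/= /parabolic_top lerBrDr.
(* On a square of side [u] the sum [2 * u ^+ 2] of four terms, each at most [C]
   with probability at least [7 / 8], exceeds [4 * C]. *)
pose u := `|C| + 2.
have u0 : 0 <= u by rewrite addr_ge0.
have uC : 4 * C < 2 * u ^+ 2.
  have := ler_norm C; have := normr_ge0 C; rewrite /u; nra.
pose x := a + u; pose y := b + u.
have ax : a <= x by rewrite lerDl.
have bY : b <= y by rewrite lerDl.
have mix0 := mixed0 x y ax bY.
set M := mkset _ in mix0.
have mM : measurable M.
  have mev p : measurable_fun setT (fun w => S w p).
    exact: (measurableT_comp (measurable_eval p) mS).
  rewrite (_ : M = setT `&` (fun w => S w (x, y) - S w (x, b) - S w (a, y)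
    + S w (a, b)) @^-1` [set~ 0]); last first.
    by apply/seteqP; split => w /=; [move=> /eqP|case=> _ /eqP].
  have mg : measurable_fun setT (fun w => S w (x, y) - S w (x, b) - S w (a, y)
    + S w (a, b)).
    by apply: measurable_funD => //; do 2 apply: measurable_funB => //.
  by apply: mg => //; exact: measurableC.
have mgt2 : measurable ([set w | C < T x b w] `|` [set w | C < T a y w]).
  exact: measurableU.
have mle2 : measurable ([set w | T x y w <= - C] `|` [set w | T a b w <= - C]).
  exact: measurableU.
have cover : [set: O] `<=`
    ([set w | C < T x b w] `|` [set w | C < T a y w]) `|`
    ([set w | T x y w <= - C] `|` [set w | T a b w <= - C]) `|` M.
  move=> w _; have [/eqP mixw|] := boolP
    (S w (x, y) - S w (x, b) - S w (a, y) + S w (a, b) == 0); last by right.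
  left; have [h1|h1] := ltP C (T x b w); first by left; left.
  have [h2|h2] := ltP C (T a y w); first by left; right.
  have [h3|h3] := leP (T x y w) (- C); first by right; left.
  right; right => /=; move: h1 h2 h3; rewrite /T /x /y in mixw *; nra.
have : (P [set: O] <= (8^-1)%:E + (8^-1)%:E + ((8^-1)%:E + (8^-1)%:E) + 0)%E.
  apply: (le_trans (le_measure _ _ _ cover)); rewrite ?inE//.
    by apply: measurableU => //; exact: measurableU.
  apply: (le_trans (measureU2 P _ mM)); first exact: measurableU.
  apply: leeD; last by move/eqP: mix0; rewrite eq_le => /andP[].
  apply: (le_trans (measureU2 P mgt2 mle2)); apply: leeD.
    apply: (le_trans (measureU2 P (mgt x b) (mgt a y))).
    by apply: leeD; exact: Pgt.
  apply: (le_trans (measureU2 P (mle x y) (mle a b))).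
  by apply: leeD; exact: Ple.
rewrite (@probability_setT _ _ _ P) adde0 -!EFinD lee_fin; lra.
Qed.
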